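(* Let $n\ge 2$, let $\Omega\subset\mathbb{R}^n$ be an open, bounded and connected domain with smooth boundary, let $T>0$, and write $M=\overline{\Omega}\times[0,T]$ and $\Sigma=\partial\Omega\times(0,T)$. Let $\Gamma\subset\Sigma$ be open and suppose that there is a lightlike hyperplane in $\mathbb{R}^{n+1}$ that intersects the interior of $M$ but does not intersect the closure of $\Gamma$. Then there is an infinite family $\mathcal{G}$ of smooth Lorentzian metrics on $M$ such that for all $g\in\mathcal{G}$ there holds $$\Lambda_g^{\Gamma,\Gamma}=\Lambda_\eta^{\Gamma,\Gamma}.$$ Here $g$ is not isometric to $\eta$, that is, for every $g\in\mathcal{G}$ there is no diffeomorphism $\phi:M\to M$ satisfying $\phi^*\eta=g$ and $\phi|_\Gamma=\mathrm{Id}$. Moreover, every $g\in\mathcal{G}$ is of the form $g=c\,\eta$ for some conformal factor $c$ (a smooth strictly positive function on $M$), and the family $\mathcal{G}$ is not bounded in the $L^\infty$-norm.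
   Context: Points of $\mathbb{R}^{n+1}=\mathbb{R}^n\times\mathbb{R}$ are written $(x,t)$, with $t$ the time variable. $\eta=\mathrm{diag}(-1,1,\ldots,1)$ is the Minkowski metric, where the entry $-1$ corresponds to $t$. A hyperplane in $\mathbb{R}^{n+1}$ is lightlike if its normal vector with respect to the Minkowski metric is lightlike; explicitly, it is given by an equation $(x-x_0)\cdot\theta-(t-t_0)=0$ for some fixed $(x_0,t_0)\in\mathbb{R}^{n+1}$ and some Euclidean unit vector $\theta\in\mathbb{R}^n$. All Lorentzian metrics $g$ on $M$ considered are smooth and such that $\partial_t$ is timelike, $g(\partial_t,\partial_t)<0$. The wave operator of $g$ is $$\square_g u=-\frac{1}{|g|^{1/2}}\partial_a\left(|g|^{1/2}g^{ab}\partial_b u\right),$$ with $|g|$ the absolute value of the determinant of $(g_{ab})$. For $u_0\in C_0^\infty(\Sigma)$ let $u$ be the unique solution of $$\square_g u=0\ \text{in } M,\qquad u=u_0\ \text{on }\Sigma,\qquad u|_{t=0}=0,\ \partial_t u|_{t=0}=0\ \text{on }\Omega.$$ The Dirichlet-to-Neumann map is $\Lambda_g:C_0^\infty(\Sigma)\to C^\infty(\Sigma)$, $\Lambda_g u_0=\partial_\nu u|_\Sigma$, where $\partial_\nu$ is the (outward unit) normal derivative on $\Sigma$ defined with respect to $g$. For open $\Gamma_1,\Gamma_2\subset\Sigma$, the partial data map is $\Lambda_g^{\Gamma_1,\Gamma_2}:C_0^\infty(\Gamma_1)\to C^\infty(\Gamma_2)$, $\Lambda_g^{\Gamma_1,\Gamma_2}u_0=(\Lambda_g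 u_0)|_{\Gamma_2}$. The $L^\infty$-norm of a metric on $M$ is that of its components in the Cartesian coordinates of $\mathbb{R}^{n+1}$. *)

(* Defs.v *)
From HB Require Import structures.
From mathcomp Require Import all_boot all_order all_algebra.
From mathcomp Require Import all_classical all_reals all_analysis.
Set Implicit Arguments.
Unset Strict Implicit.
Unset Printing Implicit Defensive.
Import Order.TTheory GRing.Theory Num.Theory.
Import numFieldNormedType.Exports.
Local Open Scope classical_set_scope.
Local Open Scope ring_scope.

(** Points (x, t) of R^n x R are row vectors of size 1 + n with the time
    coordinate FIRST, so that eta = diag(-1, 1, ..., 1).

    An object that is smooth on the closed set M is represented by a C^oo
    extension to all of R^(1+n), and only its restriction to M is ever
    constrained.  Since M is the closure of its interior, all derivatives at
    points of M depend on that restriction only. *)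

Section Defs.
Context {R : realType}.

Definition pderiv m (a : 'I_m) (f : 'rV[R]_m -> R) : 'rV[R]_m -> R :=
  fun p => 'D_(delta_mx 0 a) f p.

(* C^oo on R^m: all iterated partial derivatives exist and are continuous. *)
Definition smooth m (f : 'rV[R]_m -> R) : Prop :=
  forall s : seq 'I_m,
    continuous (foldr (@pderiv m) f s) /\
    forall a p, derivable (foldr (@pderiv m) f s) p (delta_mx 0 a).

Definition smooth_map m k (F : 'rV[R]_m -> 'rV[R]_k) : Prop :=
  forall j, smooth (fun p => F p 0 j).

Definition boundary m (A : set 'rV[R]_m) : set 'rV[R]_m :=
  closure A `\` interior A.

Definition local_defining_function m (Omega : set 'rV[R]_m) (x0 : 'rV[R]_m)
    (rho : 'rV[R]_m -> R) : Prop :=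
  [/\ smooth rho,
      exists v, 'D_v rho x0 != 0 &
      \forall x \near x0,
        (Omega x <-> rho x < 0) /\ (boundary Omega x <-> rho x = 0)].

Definition has_smooth_boundary m (Omega : set 'rV[R]_m) : Prop :=
  forall x0, boundary Omega x0 ->
    exists rho, local_defining_function Omega x0 rho.

Section Spacetime.
Variable n : nat.
Implicit Types (p v w : 'rV[R]_(1 + n)) (Omega : set 'rV[R]_n) (T : R).
Implicit Types (g : 'rV[R]_(1 + n) -> 'M[R]_(1 + n)).
Implicit Types (u f h : 'rV[R]_(1 + n) -> R).

Definition tcoord p : R := (lsubmx p : 'rV[R]_1) 0 0.
Definition xcoord p : 'rV[R]_n := rsubmx p.
Definition dt : 'rV[R]_(1 + n) := row_mx 1%:M 0.

Definition cylinder Omega T : set 'rV[R]_(1 + n) :=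
  [set p | closure Omega (xcoord p) /\ 0 <= tcoord p <= T].

Definition lateral Omega T : set 'rV[R]_(1 + n) :=
  [set p | boundary Omega (xcoord p) /\ 0 < tcoord p < T].

Definition relatively_open (S Gamma : set 'rV[R]_(1 + n)) : Prop :=
  exists2 U : set 'rV[R]_(1 + n), open U & Gamma = S `&` U.

Definition lightlike_hyperplane (H : set 'rV[R]_(1 + n)) : Prop :=
  exists (x0 : 'rV[R]_n) (t0 : R) (theta : 'rV[R]_n),
    \sum_i theta 0 i ^+ 2 = 1 /\
    H = [set p | \sum_i (xcoord p 0 i - x0 0 i) * theta 0 i
                 - (tcoord p - t0) = 0].

Definition minkowski_mx : 'M[R]_(1 + n) := block_mx (- 1)%:M 0 0 1%:M.

Definition minkowski_metric : 'rV[R]_(1 + n) -> 'M[R]_(1 + n) := fun=> minkowski_mx.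

(* The bilinear form with matrix A. *)
Definition form (A : 'M[R]_(1 + n)) v w : R := (v *m A *m w^T) 0 0.

(* Symmetric of signature (-, +, ..., +). *)
Definition lorentzian (A : 'M[R]_(1 + n)) : Prop :=
  A^T = A /\ exists2 P : 'M[R]_(1 + n), P \in unitmx & A = P *m minkowski_mx *m P^T.

Definition smooth_lorentzian_metric (M : set 'rV[R]_(1 + n)) g : Prop :=
  (forall a b, smooth (fun p => g p a b)) /\
  forall p, M p -> lorentzian (g p) /\ form (g p) dt dt < 0.

(* The components are continuous and M is the closure of its interior, so the
   supremum is the essential supremum. *)
Definition Linfty_norm (M : set 'rV[R]_(1 + n)) g : \bar R :=
  ereal_sup [set y | exists p a b, M p /\ y = `|g p a b|%:E].

(* 'J phi p a c is d_a phi^c at p. *)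
Definition pullback (phi : 'rV[R]_(1 + n) -> 'rV[R]_(1 + n)) g :
    'rV[R]_(1 + n) -> 'M[R]_(1 + n) :=
  fun p => 'J phi p *m g (phi p) *m ('J phi p)^T.

Definition diffeomorphism (M : set 'rV[R]_(1 + n))
    (phi : 'rV[R]_(1 + n) -> 'rV[R]_(1 + n)) : Prop :=
  smooth_map phi /\ {homo phi : p / M p} /\
  exists psi : 'rV[R]_(1 + n) -> 'rV[R]_(1 + n),
    [/\ smooth_map psi, {homo psi : p / M p},
        forall p, M p -> psi (phi p) = p &
        forall p, M p -> phi (psi p) = p].

Definition vol g p : R := Num.sqrt `|\det (g p)|.

Definition box g u p : R :=
  - (vol g p)^-1 *
    \sum_a \sum_b
      pderiv a (fun q => vol g q * invmx (g q) a b * pderiv b u q) p.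

Definition wave_solution Omega T g f u : Prop :=
  [/\ smooth u,
      forall p, cylinder Omega T p -> box g u p = 0,
      forall p, lateral Omega T p -> u p = f p &
      forall p, Omega (xcoord p) -> tcoord p = 0 ->
        u p = 0 /\ 'D_dt u p = 0].

(* C_0^oo(Gamma) for Gamma open in lateral Omega T; only the values of f on
   lateral Omega T matter. *)
Definition test_function Omega T (Gamma : set 'rV[R]_(1 + n)) f : Prop :=
  (exists2 F, smooth F & forall p, lateral Omega T p -> f p = F p) /\
  exists K : set 'rV[R]_(1 + n),
    [/\ compact K, K `<=` Gamma &
        forall p, lateral Omega T p -> ~ K p -> f p = 0].

(* nu is the outward unit normal to the lateral boundary at p with respect to
   g; the tangent space there is the kernel of d(rho o xcoord). *)
Definition outward_unit_normal Omega g p nu : Prop :=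
  exists rho : 'rV[R]_n -> R,
    [/\ local_defining_function Omega (xcoord p) rho,
        forall v, 'D_(xcoord v) rho (xcoord p) = 0 -> form (g p) nu v = 0,
        form (g p) nu nu = 1 &
        0 < 'D_(xcoord nu) rho (xcoord p)].

(* The graph of Lambda_g.  Unique solvability of the initial boundary value
   problem is what makes it the graph of a map; it is not built in here. *)
Definition DN_map Omega T g :
    set (('rV[R]_(1 + n) -> R) * ('rV[R]_(1 + n) -> R)) :=
  [set fh | test_function Omega T (lateral Omega T) fh.1 /\
     exists2 u, wave_solution Omega T g fh.1 u &
       forall p, lateral Omega T p ->
         exists2 nu, outward_unit_normal Omega g p nu & fh.2 p = 'D_nu u p].

Definition partial_DN_map Omega T g (Gamma1 Gamma2 : set 'rV[R]_(1 + n)) :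
    set (('rV[R]_(1 + n) -> R) * ('rV[R]_(1 + n) -> R)) :=
  [set fh | test_function Omega T Gamma1 fh.1 /\
     exists2 h, DN_map Omega T g (fh.1, h) & fh.2 = h \_ Gamma2].

End Spacetime.
End Defs.

(* Main.v *)
Require Import Defs.
From HB Require Import structures.
From mathcomp Require Import all_boot all_order all_algebra.
From mathcomp Require Import all_classical all_reals all_analysis.
From mathcomp Require Import ring lra.
Set Implicit Arguments.
Unset Strict Implicit.
Unset Printing Implicit Defensive.
Import Order.TTheory GRing.Theory Num.Theory.
Import numFieldNormedType.Exports.
Local Open Scope classical_set_scope.
Local Open Scope ring_scope.

(** Conformal counterexamples.  If L is a null covector, every function E of the
    phase L.p + s has a null gradient, so E and its powers solve the Minkowski wave
    equation.  Put g = E^4 eta in dimension n + 1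
    and w = E^(n-1); since box_eta w = 0,
      box_g u = E^(-2(n+1)) w box_eta (w u),
    so u |-> w u carries solutions for g to solutions for eta.  If E = 1 + k b with
    a bump b in the phase supported near the given hyperplane, then w = 1 near
    Gamma, and the two problems have the same data on Gamma.

    Non-isometry does not use the condition on Gamma.  If phi pulls eta back to g,
    the image of a vertical segment {x} x [0,T] has time component with derivative
    at least E^2 >= 1 in absolute value, and more than 1 where E > 1; so it covers a
    time interval longer than T and leaves M. *)

(** * Smooth functions *)

Section SmoothFunctions.
Context {R : realType}.

(** Coinduction for smoothness: stability of [S] under [pderiv] carries membership along any list of
    indices, so no iterated derivative has to be computed. *)
Lemma smooth_coind m (S : set ('rV[R]_m -> R)) :
  (forall f, S f -> [/\ continuous f,
     forall a p, derivable f p (delta_mx 0 a) & forall a, S (pderiv a f)]) ->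
  forall f, S f -> smooth f.
Proof.
move=> HS f Sf s; have : S (foldr (@pderiv R m) f s).
  by elim: s => //= a s IH; case: (HS _ IH).
by case/HS.
Qed.

Lemma smooth_pderiv m (f : 'rV[R]_m -> R) a : smooth f -> smooth (pderiv a f).
Proof. by move=> sf s; have := sf (rcons s a); rewrite foldr_rcons. Qed.

Lemma smooth_continuous m (f : 'rV[R]_m -> R) : smooth f -> continuous f.
Proof. by move=> sf; case: (sf [::]). Qed.

Lemma smooth_derivable m (f : 'rV[R]_m -> R) a p :
  smooth f -> derivable f p (delta_mx 0 a).
Proof. by move=> sf; case: (sf [::]). Qed.

(** Restricting [f] to the line through [p] with direction [v] reduces this to the one-variable
    chain rule. Only a directional derivative of [f] is assumed, which is all that [smooth] provides
    directly. *)
Lemma derivable_comp_dir (V : normedModType R) (h : R -> R) (f : V -> R) p v :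
  derivable f p v -> derivable h (f p) 1 ->
  derivable (h \o f) p v /\ 'D_v (h \o f) p = derive1 h (f p) * 'D_v f p.
Proof.
move=> /derivable1P df dh.
pose k (t : R) := f (t *: v + p).
have k0 : k 0 = f p by rewrite /k scale0r add0r.
have Dk (F : V -> R) : 'D_v F p = derive1 (fun t : R => F (t *: v + p)) 0.
  rewrite derive1E /derive; set g1 := fun t => t^-1 *: _; set g2 := fun t => t^-1 *: _.
  suff -> : g1 = g2 by [].
  by rewrite funeqE /g1 /g2 => t /=; rewrite addr0 scale0r add0r [_%:A]mulr1.
have dk : derivable k 0 1 := df.
have dhk : derivable h (k 0) 1 by rewrite k0.
split.
  apply/derivable1P; apply: (diff_derivable (f := h \o k)).
  have /derivable1_diffP dk' := dk.
  have /derivable1_diffP dh' := dhk.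
  exact: differentiable_comp.
have hk := derive1_comp dk dhk.
by rewrite !Dk -k0; exact: hk.
Qed.

Definition smooth1 (h : R -> R) := forall k x, derivable (derive1n k h) x 1.

Lemma smooth1_derive h : smooth1 h -> smooth1 (derive1 h).
Proof. by move=> sh k x; have := sh k.+1 x; rewrite derive1Sn. Qed.

Lemma smooth1_coind (S : set (R -> R)) :
  (forall h, S h -> (forall x, derivable h x 1) /\ S (derive1 h)) ->
  forall h, S h -> smooth1 h.
Proof.
move=> HS h Sh k; have : S (derive1n k h).
  by elim: k => [//|k IH]; rewrite derive1nS; case: (HS _ IH).
by case/HS.
Qed.

(** The derivative of a product, inverse or composite mixes several operations, so no single
    operation gives a class stable under [pderiv]. Closing under all of them at once does, and one
    coinduction then covers every case. *)
Inductive smooth_closure m : ('rV[R]_m -> R) -> Prop :=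
| closure_smooth f : smooth f -> smooth_closure f
| closure_cst c : smooth_closure (cst c)
| closureD f g : smooth_closure f -> smooth_closure g -> smooth_closure (f + g)
| closureM f g : smooth_closure f -> smooth_closure g -> smooth_closure (f * g)
| closureV f : (forall p, f p != 0) -> smooth_closure f ->
    smooth_closure (fun p => (f p)^-1)
| closure_comp h f : smooth1 h -> smooth_closure f -> smooth_closure (h \o f).

Lemma smooth_closureP m (f : 'rV[R]_m -> R) : smooth_closure f -> smooth f.
Proof.
apply: smooth_coind f => f; elim=> {f}.
- move=> f sf; split; first exact: smooth_continuous.
    by move=> a p; exact: smooth_derivable.
  by move=> a; apply: closure_smooth; exact: smooth_pderiv.
- move=> c; split; [exact: cst_continuous | by move=> a p; exact: derivable_cst|].
  move=> a; have -> : pderiv a (cst c) = cst 0 :> ('rV[R]_m -> R).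
    by apply/funext => p; rewrite /pderiv derive_cst.
  exact: closure_cst.
- move=> f g af [cf df sf] ag [cg dg sg]; split.
  + by move=> p; apply: continuousD; [exact: cf|exact: cg].
  + by move=> a p; exact: derivableD.
  + move=> a; have -> : pderiv a (f + g) = pderiv a f + pderiv a g.
      by apply/funext => p; rewrite /pderiv deriveD.
    exact: closureD.
- move=> f g af [cf df sf] ag [cg dg sg]; split.
  + by move=> p; apply: continuousM; [exact: cf|exact: cg].
  + by move=> a p; exact: derivableM.
  + move=> a; have -> : pderiv a (f * g) = f * pderiv a g + g * pderiv a f.
      by apply/funext => p; rewrite /pderiv deriveM.
    by apply: closureD; apply: closureM.
- move=> f f0 af [cf df sf]; split.
  + by move=> p; apply: continuousV => //; exact: cf.
  + by move=> a p; exact: derivableV.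
  + move=> a; have -> : pderiv a (fun p => (f p)^-1) =
        cst (-1) * ((fun p => (f p)^-1) * ((fun p => (f p)^-1) * pderiv a f)).
      apply/funext => p; rewrite /pderiv deriveV//= /GRing.scale/=.
      by rewrite !fctE/= mulN1r -exprVn mulNr expr2 mulrA.
    apply: closureM; first exact: closure_cst.
    by do !apply: closureM => //; apply: closureV.
- move=> h f sh af [cf df sf].
  have dh x : derivable h x 1 by exact: (sh 0%N).
  split.
  + move=> p; apply: continuous_comp; first exact: cf.
    by apply: differentiable_continuous; apply/derivable1_diffP.
  + by move=> a p; case: (derivable_comp_dir (df a p) (dh (f p))).
  + move=> a; have -> : pderiv a (h \o f) = (derive1 h \o f) * pderiv a f.
      apply/funext => p; rewrite /pderiv.
      by case: (derivable_comp_dir (df a p) (dh (f p))).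
    by apply: closureM => //; apply: closure_comp => //; exact: smooth1_derive.
Qed.

Lemma smooth_cst m c : smooth (cst c : 'rV[R]_m -> R).
Proof. exact/smooth_closureP/closure_cst. Qed.

Lemma smoothD m (f g : 'rV[R]_m -> R) : smooth f -> smooth g -> smooth (f + g).
Proof. by move=> sf sg; apply/smooth_closureP/closureD; exact: closure_smooth. Qed.

Lemma smoothM m (f g : 'rV[R]_m -> R) : smooth f -> smooth g -> smooth (f * g).
Proof. by move=> sf sg; apply/smooth_closureP/closureM; exact: closure_smooth. Qed.

Lemma smoothX m (f : 'rV[R]_m -> R) k : smooth f -> smooth (fun p => f p ^+ k).
Proof.
move=> sf; elim: k => [|k IH]; first exact: smooth_cst.
have -> : (fun p => f p ^+ k.+1) = f * (fun p => f p ^+ k).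
  by apply/funext => p; rewrite exprS.
exact: smoothM.
Qed.

Lemma smoothV m (f : 'rV[R]_m -> R) :
  (forall p, f p != 0) -> smooth f -> smooth (fun p => (f p)^-1).
Proof. by move=> f0 sf; apply/smooth_closureP/closureV => //; exact: closure_smooth. Qed.

Lemma smooth_comp m h (f : 'rV[R]_m -> R) : smooth1 h -> smooth f -> smooth (h \o f).
Proof. by move=> sh sf; apply/smooth_closureP/closure_comp => //; exact: closure_smooth. Qed.

Lemma pderivD m (f g : 'rV[R]_m -> R) a : smooth f -> smooth g ->
  pderiv a (f + g) = pderiv a f + pderiv a g.
Proof. by move=> sf sg; apply/funext => p; rewrite /pderiv deriveD//; exact: smooth_derivable. Qed.

Lemma pderivM m (f g : 'rV[R]_m -> R) a : smooth f -> smooth g ->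
  pderiv a (f * g) = f * pderiv a g + g * pderiv a f.
Proof. by move=> sf sg; apply/funext => p; rewrite /pderiv deriveM//; exact: smooth_derivable. Qed.

Lemma pderiv_cst m c a : pderiv a (cst c : 'rV[R]_m -> R) = cst 0.
Proof. by apply/funext => p; rewrite /pderiv derive_cst. Qed.

Lemma pderiv_comp m h (f : 'rV[R]_m -> R) a : smooth1 h -> smooth f ->
  pderiv a (h \o f) = (derive1 h \o f) * pderiv a f.
Proof.
move=> sh sf; apply/funext => p; rewrite /pderiv.
by case: (derivable_comp_dir (@smooth_derivable _ f a p sf) (sh 0%N (f p))).
Qed.

Lemma derive_coord m (j : 'I_m) (p v : 'rV[R]_m) :
  derivable (fun q : 'rV[R]_m => q 0 j) p v /\ 'D_v (fun q : 'rV[R]_m => q 0 j) p = v 0 j.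
Proof.
have d : derivable (id : 'rV[R]_m -> 'rV[R]_m) p v by exact: derivable_id.
split; first exact/diff_derivable/differentiable_coord.
have := derive_mx d; rewrite derive_id => /matrixP/(_ 0 j).
by rewrite mxE => ->.
Qed.

Lemma smooth_coord m (j : 'I_m) : smooth (fun q : 'rV[R]_m => q 0 j).
Proof.
pose S := [set f : 'rV[R]_m -> R | f = (fun q => q 0 j) \/ exists c, f = cst c].
apply: (smooth_coind (S := S)) (or_introl erefl) => f [->|[c ->]].
- split; [exact: coord_continuous|by move=> a p; case: (derive_coord j p (delta_mx 0 a))|].
  move=> a; right; exists ((delta_mx 0 a : 'rV[R]_m) 0 j); apply/funext => p.
  by rewrite /pderiv; case: (derive_coord j p (delta_mx 0 a)).
- split; [exact: cst_continuous | by move=> a p; exact: derivable_cst|].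
  by move=> a; right; exists 0; rewrite pderiv_cst.
Qed.

End SmoothFunctions.

(** * A flat function *)

Section FlatFunction.
Context {R : realType}.

(** The family over all [P] is stable under differentiation, whereas exp(-1/x) alone is not. *)
Definition flat_poly (P : {poly R}) (x : R) : R :=
  if 0 < x then P.[x^-1] * expR (- x^-1) else 0.

(** With y = 1/x, the exponential series gives y^(i+1) <= (i+1)! exp y, hence y^i exp(-y) <= (i+1)!
    x for each monomial. The factor x is what controls difference quotients at 0. *)
Lemma flat_poly_bound P : exists2 C, 0 <= C & forall x, `|flat_poly P x| <= C * `|x|.
Proof.
exists (\sum_(i < size P) `|P`_i| * (i.+1)`!%:R).
  by apply: sumr_ge0 => i _; rewrite mulr_ge0.
move=> x; rewrite /flat_poly; case: ifPn => [x0|_]; last first.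
  by rewrite normr0 mulr_ge0//; apply: sumr_ge0 => i _; rewrite mulr_ge0.
rewrite (gtr0_norm x0) horner_coef mulr_suml mulr_suml.
apply: le_trans (ler_norm_sum _ _ _) _; apply: ler_sum => i _.
have y0 : 0 < x^-1 by rewrite invr_gt0.
rewrite !normrM -!mulrA ler_wpM2l// normrX (gtr0_norm y0) (gtr0_norm (expR_gt0 _)).
rewrite expRN ler_pdivrMr ?expR_gt0//.
have := expR_ge1Dxn i (ltW y0) => h.
have {h} : x^-1 ^+ i.+1 / (i.+1)`!%:R <= expR x^-1 by apply: le_trans h; rewrite lerDr.
rewrite ler_pdivrMr ?ltr0n ?fact_gt0// => h.
have -> : x^-1 ^+ i = x^-1 ^+ i.+1 * x by rewrite exprSr mulfVK// gt_eqF.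
by apply: le_trans (ler_wpM2r (ltW x0) h) _; rewrite -!mulrA mulrC -mulrA.
Qed.

(** For x > 0 put y = 1/x: since dy/dx = -y^2, the derivative of P(y) exp(-y) is (P - P')(y) y^2
    exp(-y). For x < 0 everything vanishes, and 0 is treated by the linear bound. *)
Lemma derive_flat_poly P x :
  derivable (flat_poly P) x 1 /\
  derive1 (flat_poly P) x = flat_poly ((P - P^`()) * 'X^2) x.
Proof.
have [x0|x0|->] := ltgtP x 0.
- have e : \forall y \near x, flat_poly P y = cst 0 y.
    by near=> y; rewrite /flat_poly ifN// -leNgt ltW//; near: y; exact: lt_nbhsl.
  split.
    apply: near_eq_derivable (derivable_cst 0 x 1).
    by near=> y; apply/esym; near: y; exact: e.
  rewrite derive1E (near_eq_derive _ e) derive_cst /flat_poly ifN// -leNgt ltW//.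
- have e : \forall y \near x, flat_poly P y = P.[y^-1] * expR (- y^-1).
    by near=> y; rewrite /flat_poly ifT//; near: y; exact: lt_nbhsr.
  have xn0 : x != 0 by rewrite gt_eqF.
  have dV : is_derive x 1 (fun y : R => y^-1) (- x ^- 2).
    have dx : derivable (id : R -> R) x 1 by exact: derivable_id.
    split; first exact: (@derivableV _ _ id).
    by rewrite (@deriveV _ _ id)// derive_id [_ *: _]mulr1.
  have dP : is_derive x 1 (fun y : R => P.[y^-1]) (P^`().[x^-1] * (- x ^- 2)).
    have [d1 d2] := derivable_comp_dir (h := horner P)
      (@ex_derive _ _ _ _ _ _ _ dV) (@derivable_horner _ P _).
    by split => //; rewrite d2 -derivE derive_val.
  have dE : is_derive x 1 (fun y : R => expR (- y^-1)) (expR (- x^-1) * x ^- 2).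
    have dN : is_derive x 1 (fun y : R => - y^-1) (x ^- 2).
      by apply: is_derive_eq; rewrite opprK.
    have [d1 d2] := derivable_comp_dir (h := expR)
      (@ex_derive _ _ _ _ _ _ _ dN) (@derivable_expR _ _).
    by split => //; rewrite d2 derive1E (congr1 (fun k => k (- x^-1)) (derive_expR R)) derive_val.
  have dPE : is_derive x 1 (fun y => P.[y^-1] * expR (- y^-1)) 
      (P.[x^-1] * (expR (- x^-1) * x ^- 2) + expR (- x^-1) * (P^`().[x^-1] * (- x ^- 2))).
    exact: (is_deriveM dP dE).
  split.
    apply: near_eq_derivable (@ex_derive _ _ _ _ _ _ _ dPE).
    by near=> y; apply/esym; near: y; exact: e.
  rewrite derive1E (near_eq_derive _ e) derive_val /flat_poly ifT//.
  rewrite hornerM hornerD hornerN hornerXn -exprVn; ring.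
(* Dividing by h turns [P] into [P * 'X], so the difference quotient at 0 is itself a [flat_poly]
   and is at most C |h|. *)
- have [C C0 hC] := flat_poly_bound (P * 'X).
  have F0 Q : flat_poly Q 0 = 0 by rewrite /flat_poly ltxx.
  have cv : (fun h : R => h^-1 *: (flat_poly P (h *: 1 + 0) - flat_poly P 0)) @ 0^' --> (0 : R).
    apply/cvgrPdist_le => /= eps eps0; near=> h.
    rewrite sub0r normrN F0 subr0 addr0 [h%:A]mulr1.
    have -> : h^-1 *: flat_poly P h = flat_poly (P * 'X) h.
      rewrite /flat_poly; case: ifPn => _; last by rewrite scaler0.
      by rewrite hornerM hornerX /GRing.scale/=; ring.
    apply: le_trans (hC h) _.
    have h1 : `|h| <= eps / (C + 1).
      near: h; apply: dnbhs0_le; rewrite divr_gt0//; lra.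
    have C1 : 0 < C + 1 by lra.
    apply: (@le_trans _ _ ((C + 1) * `|h|)); first by rewrite ler_wpM2r//; lra.
    by rewrite mulrC -ler_pdivlMr.
  split; first by apply/cvg_ex; exists 0.
  by rewrite derive1E F0; exact: cvg_lim cv.
Unshelve. all: by end_near. Qed.

Lemma smooth1_flat_poly P : smooth1 (flat_poly P).
Proof.
apply: (@smooth1_coind _ (range flat_poly)); last by exists P.
move=> _ [Q _ <-]; split=> [x|]; first by case: (derive_flat_poly Q x).
exists ((Q - Q^`()) * 'X^2) => //.
by apply/funext => x; case: (derive_flat_poly Q x).
Qed.

Definition flat : R -> R := flat_poly 1.

Lemma smooth1_flat : smooth1 flat. Proof. exact: smooth1_flat_poly. Qed.

Lemma flat_ge0 x : 0 <= flat x.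
Proof. by rewrite /flat /flat_poly; case: ifP => // _; rewrite hornerE mul1r expR_ge0. Qed.

Lemma flat_gt0 x : 0 < x -> 0 < flat x.
Proof. by move=> x0; rewrite /flat /flat_poly x0 hornerE mul1r expR_gt0. Qed.

Lemma flat_eq0 x : x <= 0 -> flat x = 0.
Proof. by move=> x0; rewrite /flat /flat_poly ltNge x0. Qed.

End FlatFunction.

(** * Continuously differentiable functions *)

Section ContinuouslyDifferentiable.
Context {R : realType}.

Lemma is_derive_line (V : normedModType R) (f : V -> R) q v s :
  derivable f (s *: v + q) v ->
  is_derive s (1 : R) (fun t => f (t *: v + q)) ('D_v f (s *: v + q)).
Proof.
move=> df.
have e : (fun h : R => h^-1 *: (((fun t : R => f (t *: v + q)) \o shift s) (h *: 1)
            - f (s *: v + q))) =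
         (fun h : R => h^-1 *: ((f \o shift (s *: v + q)) (h *: v) - f (s *: v + q))).
  by apply/funext => h /=; rewrite [h%:A]mulr1 scalerDl addrA.
by split; rewrite /derivable /derive e.
Qed.

(** The bound [|s| <= |t|] covers both signs of [t], which will be a coordinate of an arbitrary
    increment. *)
Lemma mvt_line (V : normedModType R) (f : V -> R) v q t :
  (forall x, derivable f x v) ->
  exists2 s, `|s| <= `|t| & f (t *: v + q) - f q = t * 'D_v f (s *: v + q).
Proof.
move=> df; pose F (s : R) := f (s *: v + q).
have dF s : is_derive s (1 : R) F ('D_v f (s *: v + q)) by exact: is_derive_line.
have cF a b : {within `[a, b], continuous F}.
  apply: continuous_subspaceT => x; apply: differentiable_continuous.
  exact/derivable1_diffP.
have F0 : F 0 = f q by rewrite /F scale0r add0r.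
have [t0|t0] := leP 0 t.
- have [s + e] := MVT_segment t0 (fun s _ => dF s) (@cF _ _).
  rewrite in_itv/= => /andP[s0 st]; exists s; first by rewrite !ger0_norm.
  by rewrite -F0 mulrC -[X in _ * X]subr0 -e.
- have [s + e] := MVT_segment (ltW t0) (fun s _ => dF s) (@cF _ _).
  rewrite in_itv/= => /andP[s0 st]; exists s.
    by rewrite !ler0_norm ?lerN2// ltW.
  by apply: oppr_inj; rewrite opprB -F0 -/(F t) e sub0r mulrN mulrC.
Qed.

Definition truncate m k (v : 'rV[R]_m) : 'rV[R]_m :=
  \row_j (if (j < k)%N then v 0 j else 0).

Lemma coord_le_norm m (v : 'rV[R]_m) j : `|v 0 j| <= `|v|.
Proof. by rewrite [leRHS]mx_normrE; exact: (le_bigmax _ _ (0, j)). Qed.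

Lemma norm_le_coord m (v : 'rV[R]_m) c :
  0 <= c -> (forall j, `|v 0 j| <= c) -> `|v| <= c.
Proof.
move=> c0 h; rewrite [leLHS]mx_normrE; apply/bigmax_leP; split => // -[i j] _.
by rewrite ord1; exact: h.
Qed.

(** This passes from partial derivatives, the only ones in [smooth], to the total differential
    needed for arbitrary directions and for Jacobians. The candidate is the linear form with the
    partial derivatives as coefficients. *)
Lemma differentiable_pderiv m (f : 'rV[R]_m -> R) (p : 'rV[R]_m) :
  (forall a q, derivable f q (delta_mx 0 a)) ->
  (forall a, {for p, continuous (pderiv a f)}) -> differentiable f p.
Proof.
move=> df cf.
pose d (v : 'rV[R]_m) := \sum_a v 0 a * pderiv a f p.
have lin_d : linear d.
  move=> c u v; rewrite /d scaler_sumr -big_split/=; apply: eq_bigr => a _.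
  by rewrite !mxE mulrDl -mulrA.
pose dM := GRing.isLinear.Build _ _ _ _ _ lin_d.
pose dL : {linear _ -> _} := HB.pack d dM.
have cd : continuous dL.
  have : continuous d; last by [].
  apply: (continuous_big add_continuous) => a _ v.
  exact: (smooth_continuous (smoothM (smooth_coord a) (smooth_cst (pderiv a f p)))) v.
pose W : normedModType R := 'rV[R]_m.
suff H : (f : W -> R) \o shift (p : W) = cst (f p) + (dL : W -> R) +o_ (0 : W) id.
  have dE := diff_unique cd H.
  by apply/diff_locallyP; rewrite dE.
apply/eqaddoP => eps eps0.
(* The error is a sum of [m] terms; dividing by [m.+1] keeps the denominator nonzero when
   [m = 0]. *)
have e0 : 0 < eps / m.+1%:R by rewrite divr_gt0.
have : \forall q \near p, forall a, `|pderiv a f p - pderiv a f q| <= eps / m.+1%:R.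
  apply: (@filter_forall _ _
    (fun a q => `|pderiv a f p - pderiv a f q| <= eps / m.+1%:R) (nbhs p)) => a.
  by have /cvgrPdist_le := cf a; exact.
move=> /nbhs_normP[del /= del0 hdel].
near=> v.
have vdel : `|v| < del.
  by near: v; have := (@nbhs0_lt _ 'rV[R]_m del del0).
(* Move from p to p + v one coordinate at a time, using the mean value theorem. *)
have teleE : f (v + p) - f p =
    \sum_(a < m) (f (truncate a.+1 v + p) - f (truncate a v + p)).
  rewrite -(big_mkord xpredT (fun k => f (truncate k.+1 v + p) - f (truncate k v + p))).
  rewrite telescope_sumr//; congr (f (_ + _) - f _).
    by apply/rowP => j; rewrite mxE ltn_ord.
  have -> : truncate 0 v = 0 by apply/rowP => j; rewrite !mxE ltn0.
  by rewrite add0r.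
rewrite !fctE/= opprD addrA teleE -sumrB.
apply: le_trans (ler_norm_sum _ _ _) _.
apply: (@le_trans _ _ (\sum_(a < m) eps / m.+1%:R * `|v|)); last first.
  rewrite sumr_const card_ord -[leLHS]mulr_natl mulrA ler_wpM2r// mulrC mulrAC.
  by rewrite ler_pdivrMr// ler_pM2l// ler_nat.
apply: ler_sum => a _.
have -> : truncate a.+1 v + p = v 0 a *: delta_mx 0 a + (truncate a v + p).
  rewrite addrA; congr (_ + _); apply/rowP => j; rewrite !mxE eqxx/=.
  have [->|ja] := eqVneq j a; first by rewrite ltnSn ltnn mulr1 addr0.
  by rewrite mulr0 add0r ltnS leq_eqVlt (negbTE (ja : (j != a :> nat))).
have [s sv ->] := mvt_line (truncate a v + p) (v 0 a) (df a).
rewrite -mulrBr normrM mulrC ler_pM//; last exact: coord_le_norm.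
(* Relative to [p], the intermediate point has the coordinates of [v] before [a], then [s], then
   zeros, so in the sup norm it is within [|v|] of [p]. *)
rewrite distrC; apply: hdel => /=.
apply: le_lt_trans vdel; rewrite addrA opprD addrCA subrr addr0 normrN.
apply: norm_le_coord => // j; rewrite !mxE eqxx/=.
have [->|ja] := eqVneq j a.
  rewrite ltnn mulr1 addr0; apply: le_trans sv _; exact: coord_le_norm.
rewrite mulr0 add0r; case: ifP => _; last by rewrite normr0.
exact: coord_le_norm.
Unshelve. all: by end_near. Qed.

Lemma smooth_differentiable m (f : 'rV[R]_m -> R) p : smooth f -> differentiable f p.
Proof.
move=> sf; apply: differentiable_pderiv => a; first by move=> q; exact: smooth_derivable.
exact/smooth_continuous/smooth_pderiv.
Qed.

Lemma deriveZdir m (f : 'rV[R]_m -> R) p (c : R) v :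
  smooth f -> 'D_(c *: v) f p = c * 'D_v f p.
Proof. by move=> sf; rewrite !deriveE ?linearZ//; exact: smooth_differentiable. Qed.

End ContinuouslyDifferentiable.

(** * The conformal change of the wave operator *)

Section ConformalWaveOperator.
Context {R : realType}.

(** Gradient f1 L and Hessian f2 L L, as for a function of the phase L.p. Stated through
    derivatives, the property passes to sums and products by the Leibniz rule. *)
Definition wave_profile m (L : 'I_m -> R) (f : 'rV[R]_m -> R) : Prop :=
  smooth f /\ exists f1 f2 : 'rV[R]_m -> R,
    [/\ smooth f1, forall a, pderiv a f = cst (L a) * f1 &
        forall a, pderiv a f1 = cst (L a) * f2].

Lemma wave_profile_cst m (L : 'I_m -> R) c : wave_profile L (cst c).
Proof.
split; first exact: smooth_cst.
exists (cst 0), (cst 0); split; first exact: smooth_cst.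
all: by move=> a; rewrite pderiv_cst; apply/funext => p; rewrite !fctE mulr0.
Qed.

Lemma wave_profileD m (L : 'I_m -> R) f g :
  wave_profile L f -> wave_profile L g -> wave_profile L (f + g).
Proof.
move=> [sf [f1 [f2 [sf1 df df1]]]] [sg [g1 [g2 [sg1 dg dg1]]]].
split; first exact: smoothD.
exists (f1 + g1), (f2 + g2); split; first exact: smoothD.
- by move=> a; rewrite pderivD// df dg mulrDr.
- by move=> a; rewrite pderivD// df1 dg1 mulrDr.
Qed.

Lemma wave_profileM m (L : 'I_m -> R) f g :
  wave_profile L f -> wave_profile L g -> wave_profile L (f * g).
Proof.
move=> [sf [f1 [f2 [sf1 df df1]]]] [sg [g1 [g2 [sg1 dg dg1]]]].
split; first exact: smoothM.
exists (f * g1 + g * f1), (f * g2 + g1 * f1 + (g * f2 + f1 * g1)); split.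
- by apply: smoothD; apply: smoothM.
- move=> a; rewrite pderivM// df dg; apply/funext => p; rewrite !fctE/=; ring.
- move=> a; rewrite pderivD; [|exact: smoothM|exact: smoothM].
  rewrite !pderivM// df dg df1 dg1; apply/funext => p; rewrite !fctE/=; ring.
Qed.

Lemma wave_profileX m (L : 'I_m -> R) f k :
  wave_profile L f -> wave_profile L (fun p => f p ^+ k).
Proof.
move=> wf; elim: k => [|k IH]; first exact: wave_profile_cst.
have -> : (fun p => f p ^+ k.+1) = f * (fun p => f p ^+ k).
  by apply/funext => p; rewrite exprS.
exact: wave_profileM.
Qed.

Definition affine m (L : 'I_m -> R) (s : R) (p : 'rV[R]_m) : R :=
  \sum_a L a * p 0 a + s.

Lemma smooth_sum m (I : Type) (r : seq I) (F : I -> 'rV[R]_m -> R) :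
  (forall i, smooth (F i)) -> smooth (fun p => \sum_(i <- r) F i p).
Proof.
move=> sF; elim: r => [|i r IH].
  have -> : (fun p => \sum_(i <- [::]) F i p) = cst 0.
    by apply/funext => p; rewrite big_nil.
  exact: smooth_cst.
have -> : (fun p => \sum_(j <- i :: r) F j p) = F i + (fun p => \sum_(j <- r) F j p).
  by apply/funext => p; rewrite big_cons.
exact: smoothD (sF i) IH.
Qed.

Lemma smooth_affine m (L : 'I_m -> R) s : smooth (affine L s).
Proof.
apply: (smoothD (f := fun p => \sum_a L a * p 0 a) (g := cst s)); last exact: smooth_cst.
by apply: smooth_sum => a; apply: smoothM; [exact: smooth_cst|exact: smooth_coord].
Qed.

Lemma pderiv_affine m (L : 'I_m -> R) s a : pderiv a (affine L s) = cst (L a).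
Proof.
apply/funext => p; rewrite /pderiv.
have -> : affine L s = cst s + \sum_b cst (L b) * (fun q : 'rV[R]_m => q 0 b).
  by apply/funext => q; rewrite /affine !fctE fct_sumE addrC.
have d b : derivable (cst (L b) * (fun q : 'rV[R]_m => q 0 b)) p (delta_mx 0 a).
  by apply: derivableM; [exact: derivable_cst|case: (derive_coord b p (delta_mx 0 a))].
rewrite deriveD; [|exact: derivable_cst|exact: derivable_sum].
rewrite derive_cst add0r derive_sum// (bigD1 a)//= big1 ?addr0 => [|b ba].
  rewrite deriveM; [|exact: derivable_cst|by case: (derive_coord a p (delta_mx 0 a))].
  rewrite derive_cst scaler0 addr0; case: (derive_coord a p (delta_mx 0 a)) => _ ->.
  by rewrite mxE !eqxx/= [_ *: _]mulr1.
rewrite deriveM; [|exact: derivable_cst|by case: (derive_coord b p (delta_mx 0 a))].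
rewrite derive_cst scaler0 addr0; case: (derive_coord b p (delta_mx 0 a)) => _ ->.
by rewrite mxE eqxx/= (negbTE ba) scaler0.
Qed.

(** The factor [c] stays outside [L] so that functions of the phase and of its negative are profiles
    for the same [L]. *)
Lemma wave_profile_affine m (L : 'I_m -> R) c s h :
  smooth1 h -> wave_profile L (h \o affine (fun a => c * L a) s).
Proof.
move=> sh; have sa := smooth_affine (fun a => c * L a) s.
have sh' := smooth1_derive sh.
split; first exact: smooth_comp.
exists (cst c * (derive1 h \o affine (fun a => c * L a) s)),
  (cst (c ^+ 2) * (derive1 (derive1 h) \o affine (fun a => c * L a) s)).
have sc := smooth_comp sh' sa.
split.
- exact: smoothM (smooth_cst c) sc.
- by move=> a; rewrite (pderiv_comp a sh sa) pderiv_affine; apply/funext => p;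
    rewrite !fctE; ring.
- move=> a; rewrite (pderivM a (smooth_cst c) sc) (pderiv_comp a sh' sa).
  by rewrite pderiv_cst pderiv_affine; apply/funext => p; rewrite !fctE; ring.
Qed.

Variable n : nat.
Local Notation eta := (@minkowski_mx R n).

Definition dalembertian (u : 'rV[R]_(1 + n) -> R) p : R :=
  \sum_a \sum_b eta a b * pderiv a (pderiv b u) p.

(** With a fourth power, the volume density and the weight c^((n-1)/4) of the conformal change are
    both integer powers of [E]. *)
Definition conformal_metric (E : 'rV[R]_(1 + n) -> R) p : 'M[R]_(1 + n) :=
  E p ^+ 4 *: eta.

Lemma minkowski_conformal : @minkowski_metric R n = conformal_metric (cst 1).
Proof. by apply/funext => p; rewrite /conformal_metric expr1n scale1r. Qed.

Lemma minkowski_mx_tr : eta^T = eta.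
Proof. by rewrite /minkowski_mx tr_block_mx !trmx0 tr_scalar_mx trmx1. Qed.

Lemma minkowski_mx_sym a b : eta a b = eta b a.
Proof. by rewrite -{1}minkowski_mx_tr mxE. Qed.

Lemma minkowski_mx_sqr : eta *m eta = 1%:M.
Proof.
rewrite /minkowski_mx mulmx_block !mulmx0 !mul0mx !addr0 add0r mulmx1.
by rewrite -scalar_mxM mulrNN mulr1 -scalar_mx_block.
Qed.

Lemma det_minkowski_mx : \det eta = - 1.
Proof. by rewrite /minkowski_mx det_ublock det_scalar1 det1 mulr1. Qed.

Lemma minkowski_mx_unit : eta \in unitmx.
Proof. by rewrite unitmxE det_minkowski_mx unitrN1. Qed.

Lemma invmx_minkowski : invmx eta = eta.
Proof.
by rewrite -[LHS]mulmx1 -minkowski_mx_sqr mulmxA mulVmx ?mul1mx// minkowski_mx_unit.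
Qed.

Lemma vol_conformal E p : vol (conformal_metric E) p = (E p ^+ 2) ^+ n.+1.
Proof.
rewrite /vol /conformal_metric detZ det_minkowski_mx mulrN1 normrN.
have -> : (E p ^+ 4) ^+ (1 + n) = ((E p ^+ 2) ^+ n.+1) ^+ 2.
  by rewrite -!exprM [(n.+1 * 2)%N]mulnC mulnA.
by rewrite normrX real_normK ?num_real// sqrtr_sqr ger0_norm// exprn_ge0// sqr_ge0.
Qed.

Lemma invmx_conformal E p : E p != 0 -> invmx (conformal_metric E p) = (E p ^+ 4)^-1 *: eta.
Proof.
move=> E0; rewrite /conformal_metric invmxZ ?invmx_minkowski//.
by rewrite unitmxZ ?minkowski_mx_unit// unitfE expf_neq0.
Qed.

(** Contracting the Hessian f2 L L with [eta] gives f2 times the Minkowski square of [L], which is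
    zero. *)
Lemma wave_profile_dalembertian (L : 'I_(1 + n) -> R) f p :
  \sum_a \sum_b eta a b * (L a * L b) = 0 -> wave_profile L f -> dalembertian f p = 0.
Proof.
move=> null [sf [f1 [f2 [sf1 df df1]]]]; rewrite /dalembertian.
transitivity (\sum_a \sum_b eta a b * (L a * L b) * f2 p).
  apply: eq_bigr => a _; apply: eq_bigr => b _.
  rewrite df (pderivM a (smooth_cst (L b)) sf1) pderiv_cst df1 !fctE/=; ring.
by under eq_bigr do rewrite -mulr_suml; rewrite -mulr_suml null mul0r.
Qed.

End ConformalWaveOperator.

(* The space dimension is [n.+1], so the weight w = E^(dimension - 1) is [E ^+ n]. *)
Section ConformalBox.
Local Opaque pderiv smooth.
Context {R : realType}.
Variable n : nat.
Local Notation eta := (@minkowski_mx R n.+1).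

(** The coefficient of the operator is [vol] times the inverse metric, which equals w^2 eta with w =
    E^n. Moreover d_a(w^2 d_b u), contracted with [eta], is w times the d'Alembertian of w u minus w
    u times that of w, and the latter vanishes. *)
Lemma box_conformal (E u : 'rV[R]_(1 + n.+1) -> R) p :
  smooth E -> (forall q, 0 < E q) ->
  (forall q, dalembertian (fun q => E q ^+ n) q = 0) -> smooth u ->
  box (conformal_metric E) u p =
  - ((E p ^+ 2) ^+ n.+2)^-1 * (E p ^+ n * dalembertian ((fun q => E q ^+ n) * u) p).
Proof.
move=> sE E0 dw su; rewrite /box vol_conformal; congr (_ * _).
have DM f g a : smooth f -> smooth g ->
    pderiv a (f * g) p = f p * pderiv a g p + g p * pderiv a f p.
  by move=> sf sg; rewrite (pderivM a sf sg).
have DD f g a : smooth f -> smooth g ->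
    pderiv a (f + g) p = pderiv a f p + pderiv a g p.
  by move=> sf sg; rewrite (pderivD a sf sg).
set w := fun q => E q ^+ n; have sw : smooth w by exact: smoothX.
have En0 q : E q != 0 by rewrite gt_eqF.
transitivity (\sum_a \sum_b eta a b * (w p * (w p * pderiv a (pderiv b u) p
    + (pderiv a w p * pderiv b u p + pderiv a w p * pderiv b u p)))).
  apply: eq_bigr => a _; apply: eq_bigr => b _.
  have -> : (fun q => vol (conformal_metric E) q * invmx (conformal_metric E q) a b
      * pderiv b u q) = cst (eta a b) * (w * w * pderiv b u).
    apply/funext => q; rewrite vol_conformal invmx_conformal// mxE !fctE/= /w.
    have -> : (E q ^+ 2) ^+ n.+2 = E q ^+ n * E q ^+ n * E q ^+ 4.
      by rewrite -!exprD -exprM; congr (_ ^+ _); rewrite mul2n -addnn !addnS !addn0 addSn.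
    by field.
  have sb := smooth_pderiv b su; have sww := smoothM sw sw.
  rewrite (pderivM a (smooth_cst (eta a b)) (smoothM sww sb)) (pderivM a sww sb).
  rewrite (pderivM a sw sw) pderiv_cst !fctE/=.
  move: (pderiv a (pderiv b u) p) (pderiv a w p) (pderiv b u p) => x y z.
  by ring.
(* By symmetry of [eta], one of the two equal cross terms may exchange its indices; together they
   are then the cross terms of d_a d_b (w u). *)
have swap : \sum_a \sum_b eta a b * (w p * (pderiv a w p * pderiv b u p)) =
            \sum_a \sum_b eta a b * (w p * (pderiv b w p * pderiv a u p)).
  rewrite [LHS]exchange_big; apply: eq_bigr => a _; apply: eq_bigr => b _.
  by rewrite [eta b a]minkowski_mx_sym.
have := dw p; rewrite /dalembertian -/w -/(w p) => dwp.
move: dwp swap; clearbody w => dwp swap.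
transitivity (\sum_a \sum_b (eta a b * (w p * (w p * pderiv a (pderiv b u) p
    + (pderiv b w p * pderiv a u p + pderiv a w p * pderiv b u p))))).
  transitivity (\sum_a \sum_b eta a b * (w p * (w p * pderiv a (pderiv b u) p))
     + \sum_a \sum_b eta a b * (w p * (pderiv a w p * pderiv b u p))
     + \sum_a \sum_b eta a b * (w p * (pderiv a w p * pderiv b u p))).
    rewrite -!big_split/=; apply: eq_bigr => a _; rewrite -!big_split/=.
    apply: eq_bigr => b _; move: (pderiv a (pderiv b u) p) (pderiv a w p) => x y.
    by move: (pderiv b u p) => z; ring.
  rewrite {1}swap.
  rewrite -!big_split/=; apply: eq_bigr => a _; rewrite -!big_split/=.
  apply: eq_bigr => b _; move: (pderiv a (pderiv b u) p) (pderiv a w p) => x y.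
  by move: (pderiv b u p) (pderiv a u p) (pderiv b w p) => z z' y'; ring.
(* Adding the vanishing term w u times the d'Alembertian of w completes the second derivative of the
   product. *)
transitivity (\sum_a \sum_b (eta a b * (w p * (w p * pderiv a (pderiv b u) p
    + (pderiv b w p * pderiv a u p + pderiv a w p * pderiv b u p))))
    + w p * u p * \sum_a \sum_b eta a b * pderiv a (pderiv b w) p).
  by rewrite dwp mulr0 addr0.
rewrite !mulr_sumr -big_split/=; apply: eq_bigr => a _.
rewrite !mulr_sumr -big_split/=; apply: eq_bigr => b _.
have sbu := smooth_pderiv b su; have sbw := smooth_pderiv b sw.
rewrite (pderivM b sw su) (DD _ _ a (smoothM sw sbu) (smoothM su sbw)).
rewrite (DM _ _ a sw sbu) (DM _ _ a su sbw).
move: (pderiv a (pderiv b u) p) (pderiv a w p) (pderiv b w p) => x y y'.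
by move: (pderiv b u p) (pderiv a u p) (pderiv a (pderiv b w) p) => z z' x'; ring.
Qed.

Lemma box_minkowski (u : 'rV[R]_(1 + n.+1) -> R) p :
  smooth u -> box (@minkowski_metric R n.+1) u p = - dalembertian u p.
Proof.
have one : (fun q : 'rV[R]_(1 + n.+1) => (cst 1 q : R) ^+ n) = cst 1.
  by apply/funext => q; exact: expr1n.
have w1 q : dalembertian (fun q : 'rV[R]_(1 + n.+1) => (cst 1 q : R) ^+ n) q = 0.
  rewrite one /dalembertian big1// => a _; rewrite big1// => b _.
  by rewrite !pderiv_cst mulr0.
move=> su; rewrite minkowski_conformal.
rewrite (box_conformal p (smooth_cst 1) (fun=> ltr01) w1 su).
rewrite one; have -> : cst 1 * u = u by apply/funext => q; rewrite fctE mul1r.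
by rewrite !expr1n invr1 mulN1r mul1r.
Qed.

End ConformalBox.

(** * Transfer of the boundary data *)

Section PartialDNMap.
Local Opaque pderiv smooth.
Context {R : realType}.

(** Inclusion of graphs, to be used in both directions. On [Gamma2] the solutions agree near each
    point and the normals coincide; elsewhere the Neumann data may differ, but restriction to
    [Gamma2] replaces them by 0. *)
Lemma partial_DN_map_sub n (Omega : set 'rV[R]_n) T g1 g2
    (Gamma1 Gamma2 : set 'rV[R]_(1 + n)) (s : 'rV[R]_(1 + n) -> R) :
  Gamma2 `<=` lateral Omega T ->
  (forall f u1, test_function Omega T Gamma1 f -> wave_solution Omega T g1 f u1 ->
     exists2 u2, wave_solution Omega T g2 f u2 &
       forall p, Gamma2 p -> \forall q \near p, u1 q = u2 q) ->
  (forall p nu, lateral Omega T p -> outward_unit_normal Omega g1 p nu ->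
     outward_unit_normal Omega g2 p (s p *: nu)) ->
  (forall p, Gamma2 p -> s p = 1) ->
  partial_DN_map Omega T g1 Gamma1 Gamma2 `<=` partial_DN_map Omega T g2 Gamma1 Gamma2.
Proof.
move=> Gl sol nrm s1 [f h'] [/= tf [h [/= tfl [u1 su1 dn1]] ->]].
have [u2 su2 u12] := sol _ _ tf su1.
(* A normal is chosen at every lateral point, with default value 0 elsewhere. *)
have /choice[nu hnu] : forall p, exists nu, lateral Omega T p ->
    outward_unit_normal Omega g1 p nu /\ h p = 'D_nu u1 p.
  move=> p; have [lp|nlp] := pselect (lateral Omega T p).
    by have [nu o e] := dn1 p lp; exists nu.
  by exists 0.
split => //; exists (fun p => 'D_(s p *: nu p) u2 p).
  split => //; exists u2 => // p lp; exists (s p *: nu p) => //.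
  by apply: nrm => //; case: (hnu p lp).
apply/funext => p /=; rewrite /patch; case: ifPn => // /set_mem Gp.
have [_ ->] := hnu p (Gl p Gp).
by rewrite s1// scale1r; apply: near_eq_derive; exact: u12.
Qed.

Lemma form_scalemx n (A : 'M[R]_(1 + n)) c v w : Defs.form (c *: A) v w = c * Defs.form A v w.
Proof. by rewrite /Defs.form -scalemxAr -scalemxAl mxE. Qed.

Lemma form_scalel n (A : 'M[R]_(1 + n)) c v w : Defs.form A (c *: v) w = c * Defs.form A v w.
Proof. by rewrite /Defs.form -!scalemxAl mxE. Qed.

Lemma form_scaler n (A : 'M[R]_(1 + n)) c v w : Defs.form A v (c *: w) = c * Defs.form A v w.
Proof. by rewrite /Defs.form linearZ/= -scalemxAr mxE. Qed.

(** Since g(nu, v) = E^2 eta(E^2 nu, v), orthogonality is unchanged, and g(nu, nu) = eta(E^2 nu, E^2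
    nu). A positive factor keeps the vector outward. *)
Lemma outward_unit_normal_conformal n (Omega : set 'rV[R]_n) E p nu : 0 < E p ->
  outward_unit_normal Omega (conformal_metric E) p nu <->
  outward_unit_normal Omega (@minkowski_metric R n) p (E p ^+ 2 *: nu).
Proof.
move=> E0; have E20 : 0 < E p ^+ 2 by rewrite exprn_gt0.
have fE v : Defs.form (conformal_metric E p) nu v =
    E p ^+ 2 * Defs.form (@minkowski_metric R n p) (E p ^+ 2 *: nu) v.
  by rewrite /conformal_metric form_scalemx form_scalel mulrA -exprD.
have xE : xcoord (E p ^+ 2 *: nu) = E p ^+ 2 *: xcoord nu by rewrite /xcoord linearZ.
split=> -[rho [ld tang unit out]]; exists rho; have [srho _ _] := ld; split.
- exact: ld.
- by move=> v /tang; rewrite fE => /eqP; rewrite mulf_eq0 gt_eqF//= => /eqP.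
- by rewrite form_scaler -fE.
- by rewrite xE (deriveZdir _ _ _ srho) mulr_gt0.
- exact: ld.
- by move=> v /tang; rewrite fE => ->; rewrite mulr0.
- by rewrite fE -form_scaler.
- by move: out; rewrite xE (deriveZdir _ _ _ srho) pmulr_rgt0.
Qed.

Variable n : nat.
Variables (Omega : set 'rV[R]_n.+1) (T : R) (Gamma : set 'rV[R]_(1 + n.+1)).
Variable E : 'rV[R]_(1 + n.+1) -> R.
Hypothesis sE : smooth E.
Hypothesis E_gt0 : forall q, 0 < E q.
Hypothesis waveE : forall q, dalembertian (fun q => E q ^+ n) q = 0.
Hypothesis E_Gamma : forall p, Gamma p -> \forall q \near p, E q = 1.

Let w q := E q ^+ n.

(** The equation transfers by [box_conformal]. Lateral values agree on [Gamma] because w = 1 there,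
    and off [Gamma] because the datum is 0; the zero Cauchy data transfer by the product rule, as w
    never vanishes. *)
Lemma wave_solution_conformal f u : test_function Omega T Gamma f -> smooth u ->
  wave_solution Omega T (conformal_metric E) f u <->
  wave_solution Omega T (@minkowski_metric R n.+1) f (w * u).
Proof.
move=> [_ [K [_ KG f0]]] su.
have sw : smooth w by exact: smoothX.
have swu : smooth (w * u) by exact: smoothM.
have w0 q : w q != 0 by rewrite gt_eqF// exprn_gt0.
have bE p : (box (conformal_metric E) u p = 0) <->
            (box (@minkowski_metric R n.+1) (w * u) p = 0).
  have X0 : (E p ^+ 2) ^+ n.+2 != 0 by rewrite !expf_neq0// gt_eqF.
  rewrite (box_conformal p sE E_gt0 waveE su) (box_minkowski p swu); split=> /eqP.
    rewrite mulNr oppr_eq0 mulf_eq0 invr_eq0 (negbTE X0) mulf_eq0 (negbTE (w0 p))/=.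
    by move=> /eqP ->; rewrite oppr0.
  by rewrite oppr_eq0 => /eqP; rewrite /w => ->; rewrite !mulr0.
have lE p : lateral Omega T p -> (u p = f p <-> (w * u) p = f p).
  move=> lp; have [Gp|nGp] := pselect (Gamma p).
    by rewrite /w !fctE (nbhs_singleton (E_Gamma Gp)) expr1n mul1r.
  rewrite f0//; last by move/KG.
  rewrite fctE; split => [->|/eqP]; first by rewrite mulr0.
  by rewrite mulf_eq0 (negbTE (w0 p)) => /eqP.
have iE p : (u p = 0 /\ 'D_(dt n.+1) u p = 0) <-> ((w * u) p = 0 /\ 'D_(dt n.+1) (w * u) p = 0).
  have -> : 'D_(dt n.+1) (w * u) p = w p * 'D_(dt n.+1) u p + u p * 'D_(dt n.+1) w p.
    by rewrite deriveM//; apply: diff_derivable; exact: smooth_differentiable.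
  rewrite fctE; split => [[-> ->]|]; first by rewrite mulr0 mul0r addr0.
  move=> [/eqP]; rewrite mulf_eq0 (negbTE (w0 p))/= => /eqP ->.
  by rewrite mul0r addr0 => /eqP; rewrite mulf_eq0 (negbTE (w0 p))/= => /eqP.
split=> -[_ b l i]; split.
- exact: swu.
- by move=> p cp; apply: (bE p).1; exact: b.
- by move=> p lp; apply: (lE p lp).1; exact: l.
- by move=> p Op tp; apply: (iE p).1; exact: i.
- exact: su.
- by move=> p cp; apply: (bE p).2; exact: b.
- by move=> p lp; apply: (lE p lp).2; exact: l.
- by move=> p Op tp; apply: (iE p).2; exact: i.
Qed.

(** One inclusion multiplies solutions by w and normals by E^2, the other divides by them; all these
    factors are 1 on [Gamma], and w is 1 near it. *)
Lemma partial_DN_map_conformal : Gamma `<=` lateral Omega T ->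
  partial_DN_map Omega T (conformal_metric E) Gamma Gamma =
  partial_DN_map Omega T (@minkowski_metric R n.+1) Gamma Gamma.
Proof.
move=> Gl; have sw : smooth w by exact: smoothX.
have w0 q : w q != 0 by rewrite gt_eqF// exprn_gt0.
have w1 p : Gamma p -> \forall q \near p, w q = 1.
  by move=> Gp; near=> q; rewrite /w (near (E_Gamma Gp) q)// expr1n.
have E1 p : Gamma p -> E p = 1 by move=> Gp; exact: nbhs_singleton (E_Gamma Gp).
apply/seteqP; split.
- apply: (partial_DN_map_sub (s := fun p => E p ^+ 2) Gl).
  + move=> f u tf su; have [smu _ _ _] := su.
    exists (w * u); first exact: (wave_solution_conformal tf smu).1 su.
    by move=> p Gp; near=> q; rewrite fctE (near (w1 p Gp) q)// mul1r.
  + move=> p nu lp; exact: (outward_unit_normal_conformal Omega nu (E_gt0 p)).1.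
  + by move=> p Gp; rewrite E1// expr1n.
- apply: (partial_DN_map_sub (s := fun p => (E p ^+ 2)^-1) Gl).
  + move=> f v tf sv; pose u := (fun q => (w q)^-1) * v.
    have [smv _ _ _] := sv; have smu : smooth u := smoothM (smoothV w0 sw) smv.
    have wu : w * u = v by apply/funext => q; rewrite !fctE mulrA divff// mul1r.
    exists u; first by apply: (wave_solution_conformal tf smu).2; rewrite wu.
    by move=> p Gp; near=> q; rewrite /u fctE (near (w1 p Gp) q)// invr1 mul1r.
  + move=> p nu lp on; apply: (outward_unit_normal_conformal Omega _ (E_gt0 p)).2.
    by rewrite scalerA divff ?scale1r// expf_neq0// gt_eqF.
  + by move=> p Gp; rewrite E1// expr1n invr1.
Unshelve. all: by end_near. Qed.

End PartialDNMap.

(** * Non-isometry *)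

Section NonIsometry.
Context {R : realType}.

Lemma gain_gt_length (k dk : R -> R) (T s0 : R) :
  (forall s : R, is_derive s (1 : R) k (dk s)) ->
  (forall s, 0 <= s <= T -> 1 <= dk s) -> 0 < s0 < T -> 1 < dk s0 ->
  T < k T - k 0.
Proof.
move=> kd dk1 /andP[s00 s0T] dks0.
have ck a b : {within `[a, b], continuous k}.
  apply: continuous_subspaceT => x; apply: differentiable_continuous.
  exact/derivable1_diffP.
have mono a b : 0 <= a -> a <= b -> b <= T -> k a - a <= k b - b.
  move=> a0 ab bT; have [c + e] := MVT_segment ab (fun s _ => kd s) (@ck _ _).
  rewrite in_itv/= => /andP[ac cb].
  have dc : 1 <= dk c by apply: dk1; rewrite (le_trans a0 ac) (le_trans cb bT).
  have : 0 <= (dk c - 1) * (b - a) by rewrite mulr_ge0; lra.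
  lra.
rewrite ltNge; apply/negP => kT.
(* [k s - s] is nondecreasing, so it is constant unless it grows strictly. *)
have e : \forall s \near s0, k s = cst (k 0) s + id s.
  near=> s.
  have s0' : 0 <= s by apply: ltW; near: s; exact: lt_nbhsr.
  have sT : s <= T by apply: ltW; near: s; exact: lt_nbhsl.
  have := mono _ _ (lexx 0) s0' sT; have := mono _ _ s0' sT (lexx T).
  rewrite /=; lra.
have := near_eq_derive (1 : R) e.
rewrite [LHS]derive_val [X in _ = X]derive_val add0r => dk1'.
by rewrite dk1' ltxx in dks0.
Unshelve. all: by end_near. Qed.

(** A continuous derivative that never vanishes on [0,T] has constant sign, so [gain_gt_length]
    applies to [k] or to [- k] and gives a net change larger than [T]. *)
Lemma steep_leaves_interval (k dk : R -> R) (T s0 : R) :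
  (forall s : R, is_derive s (1 : R) k (dk s)) -> continuous dk ->
  (forall s, 0 <= s <= T -> 0 <= k s <= T) ->
  (forall s, 0 <= s <= T -> 1 <= `|dk s|) -> 0 < s0 < T -> 1 < `|dk s0| -> False.
Proof.
move=> kd cdk kI dk1 s0T dks0; have /andP[s0_gt0 s0_ltT] := s0T.
have T0 : 0 < T by exact: lt_trans s0_ltT.
have /andP[k00 k0T] := kI 0 (introT andP (conj (lexx 0) (ltW T0))).
have /andP[kT0 kTT] := kI T (introT andP (conj (ltW T0) (lexx T))).
have dk_n0 s : 0 <= s <= T -> dk s != 0.
  by move=> /dk1; apply: contraTneq => ->; rewrite normr0 -ltNge ltr01.
have same s : 0 <= s <= T -> 0 < dk 0 * dk s.
  move=> /[dup] sT /andP[s0' sT']; rewrite ltNge; apply/negP => neg.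
  have dk0 : dk 0 != 0 by apply: dk_n0; rewrite lexx ltW.
  have dks : dk s != 0 by exact: dk_n0.
  (* A nonpositive product puts 0 between the two values, and the intermediate value theorem then
     yields a forbidden zero of [dk]. *)
  have mm : Num.min (dk 0) (dk s) <= 0 <= Num.max (dk 0) (dk s).
    rewrite ge_min le_max; move: neg; rewrite neq_lt in dk0.
    case/orP: dk0 => d0.
      by rewrite nmulr_rle0// => ->; rewrite (ltW d0) orbT.
    by rewrite pmulr_rle0// => ->; rewrite (ltW d0) orbT.
  have [c + dc] := IVT s0' (continuous_subspaceT cdk) mm.
  rewrite in_itv/= => /andP[c0 cs].
  have : dk c != 0 by apply: dk_n0; rewrite c0 (le_trans cs sT').
  by rewrite dc eqxx.
have s0I : 0 <= s0 <= T by rewrite !ltW.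
have [d0|d0] := ltP 0 (dk 0).
- have pos s : 0 <= s <= T -> 0 < dk s by move=> /same; rewrite pmulr_rgt0.
  suff : T < k T - k 0 by lra.
  apply: (gain_gt_length kd _ s0T) => [s sT|].
    by have := dk1 s sT; rewrite gtr0_norm// pos.
  by move: dks0; rewrite gtr0_norm// pos.
- have neg s : 0 <= s <= T -> dk s < 0.
    move=> sT; have d0' : dk 0 < 0 by rewrite lt_neqAle d0 dk_n0// lexx ltW.
    by move: (same s sT); rewrite nmulr_rgt0.
  have nkd s : is_derive s (1 : R) (- k) (- dk s) by exact: is_deriveN.
  suff : T < (- k) T - (- k) 0 by rewrite !fctE; lra.
  apply: (gain_gt_length nkd _ s0T) => [s sT|].
    by have := dk1 s sT; rewrite ltr0_norm// neg.
  by move: dks0; rewrite ltr0_norm// neg.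
Qed.

Lemma smooth_map_differentiable m k (F : 'rV[R]_m -> 'rV[R]_k) p :
  smooth_map F -> differentiable F p.
Proof.
move=> sF.
have -> : F = \sum_j (fun q => F q 0 j *: (delta_mx 0 j : 'rV[R]_k)).
  by apply/funext => q; rewrite fct_sumE [LHS]row_sum_delta.
apply: differentiable_sum => j; apply: differentiableZl.
exact: smooth_differentiable (sF j).
Qed.

Variable n : nat.

Lemma dtE : @dt R n = delta_mx 0 (lshift n 0).
Proof.
rewrite /dt; apply/rowP => j; rewrite !mxE; case: splitP => i ij.
  by rewrite !ord1 mxE eqxx/=; congr (_%:R); rewrite -val_eqE/= ij !ord1.
have -> : (j == lshift n 0) = false by apply/eqP => /(congr1 val)/=; rewrite ij.
by rewrite mxE andbF.
Qed.

Lemma minkowski_form_row (l : 'rV[R]_1) (r : 'rV[R]_n) :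
  Defs.form (@minkowski_mx R n) (row_mx l r) (row_mx l r) =
  - (l 0 0) ^+ 2 + \sum_i r 0 i ^+ 2.
Proof.
rewrite /Defs.form /minkowski_mx mul_row_block !mulmx0 addr0 add0r mulmx1.
rewrite tr_row_mx mul_row_col mul_mx_scalar -scalemxAl scaleN1r !mxE !big_ord1 !mxE.
by rewrite expr2; congr (_ + _); apply: eq_bigr => i _; rewrite !mxE expr2.
Qed.

Lemma minkowski_form_ge (v : 'rV[R]_(1 + n)) :
  - (v 0 (lshift n 0)) ^+ 2 <= Defs.form (@minkowski_mx R n) v v.
Proof.
rewrite -(hsubmxK v) minkowski_form_row row_mxEl lerDl.
by apply: sumr_ge0 => i _; exact: sqr_ge0.
Qed.

Lemma minkowski_form_dt : Defs.form (@minkowski_mx R n) (dt n) (dt n) = - 1.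
Proof.
rewrite /Defs.form /dt /minkowski_mx mul_row_block !mulmx0 !mul0mx !addr0 tr_row_mx.
by rewrite mul_row_col mul0mx addr0 trmx1 mulmx1 mul1mx mxE eqxx mulr1n.
Qed.

(** Let V be the image of [dt] under the differential of [phi]. Evaluating both metrics on [dt]
    gives -E^4 = eta(V, V), which is at least minus the square of the time component of V. *)
Lemma pullback_minkowski_dt (E : 'rV[R]_(1 + n) -> R) phi p :
  smooth_map phi -> pullback phi (@minkowski_metric R n) p = conformal_metric E p ->
  E p ^+ 4 <= (pderiv (lshift n 0) (fun q => phi q 0 (lshift n 0)) p) ^+ 2.
Proof.
move=> sphi iso; have dphi := smooth_map_differentiable p sphi.
pose V := dt n *m 'J phi p.
have VE : V 0 (lshift n 0) = pderiv (lshift n 0) (fun q => phi q 0 (lshift n 0)) p.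
  rewrite /V -[_ *m _]deriveEjacobian// derive_mx; last exact: diff_derivable.
  by rewrite mxE dtE.
have : Defs.form (conformal_metric E p) (dt n) (dt n) =
       Defs.form (@minkowski_mx R n) V V.
  by rewrite -iso /Defs.form /V /pullback /minkowski_metric trmx_mul !mulmxA.
rewrite /conformal_metric form_scalemx minkowski_form_dt => e.
have := minkowski_form_ge V; rewrite -e VE; lra.
Qed.

(** [steep_leaves_interval] is applied to the time component of [phi] along the vertical segment
    through [p0], which lies in the cylinder. *)
Lemma conformal_not_isometric (Omega : set 'rV[R]_n) T E p0 phi :
  interior (cylinder Omega T) p0 -> (forall p, 1 <= E p) -> 1 < E p0 ->
  smooth_map phi -> {homo phi : p / cylinder Omega T p} ->
  (forall p, cylinder Omega T p ->
     pullback phi (@minkowski_metric R n) p = conformal_metric E p) -> False.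
Proof.
move=> int E1 Ep0 sphi hphi iso.
have [clx _] := interior_subset int.
(* [q0] is the projection of [p0] to time 0, so the vertical line through it is parametrized by time
   itself. *)
set s0 := tcoord p0; pose q0 := p0 - s0 *: dt n.
have tdt : tcoord (dt n : 'rV[R]_(1 + n)) = 1.
  by rewrite /tcoord /dt row_mxKl mxE.
have xdt : xcoord (dt n : 'rV[R]_(1 + n)) = 0 by rewrite /xcoord /dt row_mxKr.
have tline s : tcoord (s *: dt n + q0) = s.
  rewrite /q0 /tcoord !(linearD, linearB, linearZ)/= !mxE.
  by move: tdt; rewrite /tcoord !mxE => ->; rewrite /s0 /tcoord !mxE; ring.
have xline s : xcoord (s *: dt n + q0) = xcoord p0.
  have xcD p v c : xcoord (c *: v + p) = c *: xcoord v + xcoord p :> 'rV[R]_n.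
    by apply/rowP => j; rewrite !mxE.
  rewrite /q0 -scaleNr [p0 + _]addrC !xcD xdt !scaler0 !add0r.
  by [].
have line_s0 : s0 *: dt n + q0 = p0 by rewrite addrC subrK.
have Mline s : 0 <= s <= T -> cylinder Omega T (s *: dt n + q0).
  by move=> sT; split; rewrite ?xline ?tline.
have cline : continuous (fun s : R => s *: dt n + q0).
  by move=> s; apply: cvgD; [exact: scalel_continuous|exact: cvg_cst].
(* The cylinder is a neighbourhood of [p0], so times slightly before and after [s0] also lie in
   [0,T]. *)
have s0T : 0 < s0 < T.
  have near_in : \forall s \near s0, 0 <= s <= T.
    have : \forall s \near s0, cylinder Omega T (s *: dt n + q0).
      by apply: cline; rewrite line_s0.
    by apply: filterS => s [_]; rewrite tline.
  have [d /= d0 hd] := (nbhs_ballP _ _).1 near_in.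
  have d2 : d / 2 < d by lra.
  have /andP[h1 _] : 0 <= s0 - d / 2 <= T.
    by apply: hd; rewrite /ball/= opprB addrCA subrr addr0 gtr0_norm; lra.
  have /andP[_ h2] : 0 <= s0 + d / 2 <= T.
    by apply: hd; rewrite /ball/= opprD addrA subrr add0r normrN gtr0_norm; lra.
  by apply/andP; split; lra.
pose a : 'I_(1 + n) := lshift n 0; pose f q := phi q 0 a.
have sf : smooth f by exact: sphi.
have abs s : 0 <= s <= T -> E (s *: dt n + q0) ^+ 2 <= `|pderiv a f (s *: dt n + q0)|.
  move=> sT; have := pullback_minkowski_dt sphi (iso _ (Mline s sT)).
  rewrite -/f -/a (exprM _ 2 2) -[leRHS]real_normK ?num_real//.
  by rewrite ler_sqr ?nnegrE// sqr_ge0.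
apply: (@steep_leaves_interval (fun s => f (s *: dt n + q0))
  (fun s => pderiv a f (s *: dt n + q0)) T s0) => //.
- move=> s; have := @is_derive_line _ _ f q0 (dt n) s.
  by rewrite dtE; apply; exact: smooth_derivable.
- move=> s; apply: (@continuous_comp _ _ _ (fun s : R => s *: dt n + q0) (pderiv a f)).
    exact: cline.
  exact: smooth_continuous (smooth_pderiv a sf) _.
- move=> s /Mline /hphi[_]; rewrite /f /tcoord.
  by rewrite mxE.
- by move=> s /abs; apply: le_trans; rewrite exprn_ege1.
- apply: lt_le_trans (abs _ _); last by rewrite !ltW//; case/andP: s0T.
  by rewrite line_s0 exprn_egt1.
Qed.

End NonIsometry.

(** * The null strip *)

Section NullStrip.
Context {R : realType}.

(* A bump in the null phase [affine L s]: as [L] will be a null covector, every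
   function of the phase solves the Minkowski wave equation. *)
Lemma strip_bump m (L : 'I_m -> R) s eps : 0 < eps -> exists b : 'rV[R]_m -> R,
  [/\ wave_profile L b, forall q, 0 <= b q, forall q, affine L s q = 0 -> b q = 1 &
      forall p, eps < `|affine L s p| -> \forall q \near p, b q = 0].
Proof.
move=> eps0; have f0 : 0 < flat eps by exact: flat_gt0.
have aff (c : R) q : affine (fun a => c * L a) (c * s + eps) q = c * affine L s q + eps.
  rewrite /affine mulrDr addrA; congr (_ + _ + _); rewrite mulr_sumr.
  by apply: eq_bigr => a _; rewrite mulrA.
(* The two factors vanish for phase at most -eps and at least eps respectively; at phase 0 both
   equal [flat eps], whence the normalization. *)
pose b q := (flat eps)^-1 ^+ 2 * (flat (1 * affine L s q + eps) * flat (-1 * affine L s q + eps)).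
exists b; split.
- have -> : b = cst ((flat eps)^-1 ^+ 2) *
    ((flat \o affine (fun a => 1 * L a) (1 * s + eps)) *
     (flat \o affine (fun a => -1 * L a) (-1 * s + eps))).
    by apply/funext => q; rewrite !fctE/= !aff.
  apply: wave_profileM; first exact: wave_profile_cst.
  by apply: wave_profileM; apply: wave_profile_affine; exact: smooth1_flat.
- move=> q; rewrite /b mulr_ge0 ?sqr_ge0//.
  by rewrite mulr_ge0// flat_ge0.
- move=> q q0; rewrite /b q0 !mulr0 !add0r exprVn expr2 mulVf//.
  by rewrite mulf_neq0// gt_eqF.
- move=> p hp.
  have ca : continuous (affine L s) by exact: smooth_continuous (smooth_affine L s).
  have : \forall q \near p, eps < `|affine L s q|.
    have cn : {for p, continuous (fun q => `|affine L s q|)}.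
      by apply: continuous_comp; [exact: ca|exact: norm_continuous].
    exact: (cvgr_gt _ cn).
  apply: filterS => q; rewrite /b ltr_normr => /orP[h|h].
    have -> : flat (-1 * affine L s q + eps) = 0 by apply: flat_eq0; lra.
    by rewrite !mulr0.
  have -> : flat (1 * affine L s q + eps) = 0 by apply: flat_eq0; lra.
  by rewrite mul0r mulr0.
Qed.

End NullStrip.

(** * The null covector of the hyperplane and its distance from the accessible boundary *)

Section Geometry.
Context {R : realType}.
Variable n : nat.

Lemma form_sum (A : 'M[R]_(1 + n)) v :
  Defs.form A v v = \sum_a \sum_b A a b * (v 0 a * v 0 b).
Proof.
rewrite /Defs.form mxE exchange_big/=; apply: eq_bigr => b _.
rewrite !mxE mulr_suml; apply: eq_bigr => a _; ring.
Qed.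

(** The covector is (-1, theta), with Minkowski square -1 + |theta|^2 = 0; the constant [s] collects
    t0 - x0.theta. *)
Lemma null_phase (H : set 'rV[R]_(1 + n)) : lightlike_hyperplane H ->
  exists (L : 'I_(1 + n) -> R) s,
    \sum_a \sum_b @minkowski_mx R n a b * (L a * L b) = 0 /\
    H = [set p | affine L s p = 0].
Proof.
move=> [x0 [t0 [theta [theta1 ->]]]].
pose v : 'rV[R]_(1 + n) := row_mx (const_mx (-1)) theta.
exists (v 0), (t0 - \sum_i x0 0 i * theta 0 i); split.
  by rewrite -form_sum minkowski_form_row theta1 mxE sqrrN expr1n addNr.
apply/funext => p /=; congr (_ = 0).
rewrite /affine big_split_ord/= big_ord1 {2}/v row_mxEl mxE.
have -> : \sum_i (xcoord p 0 i - x0 0 i) * theta 0 i =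
    \sum_(i < n) v 0 (rshift 1 i) * p 0 (rshift 1 i) - \sum_i x0 0 i * theta 0 i.
  rewrite -sumrB; apply: eq_bigr => i _; rewrite /v row_mxEr /xcoord mxE; ring.
rewrite /tcoord mxE; ring.
Qed.

Lemma closure_norm_le m (A : set 'rV[R]_m) (C : R) :
  (forall x, A x -> `|x| <= C) -> forall x, closure A x -> `|x| <= C.
Proof.
move=> AC x clx.
have cl : closed [set x : 'rV[R]_m | `|x| <= C].
  have /continuous_closedP := @norm_continuous R 'rV[R]_m.
  by move=> /(_ _ (@closed_le R C)).
suff : closure [set x : 'rV[R]_m | `|x| <= C] x by rewrite -(closure_id _).1.
by apply: closureS clx.
Qed.

Lemma lateral_bounded (Omega : set 'rV[R]_n) T : bounded_set Omega ->
  exists C : R, forall p, lateral Omega T p -> `|p| <= C.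
Proof.
(* Boundedness provides a bound for every number strictly above [M], hence [M + 1]. *)
move=> [M [_ hM]]; pose C := Num.max (M + 1) T.
have clb x : closure Omega x -> `|x| <= M + 1.
  by apply: closure_norm_le => {}x Ox; apply: hM => //; rewrite ltrDl.
exists C => p [[clp _] /andP[t0 tT]].
have C0 : 0 <= C by rewrite le_max (ltW (lt_trans t0 tT)) orbT.
apply: norm_le_coord => // j; rewrite -[p]hsubmxK.
case: (splitP j) => i ij.
  have -> : j = lshift n 0 by apply: val_inj; rewrite /= ij !ord1.
  rewrite row_mxEl -/(tcoord p) le_max gtr0_norm// (ltW tT) orbT//.
have -> : j = rshift 1 i by apply: val_inj; rewrite /= ij.
rewrite row_mxEr; apply: le_trans (coord_le_norm _ _) _.
by rewrite le_max clb.
Qed.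

(** The closure of [Gamma] is compact, so its image under [f] is closed; as the image misses 0, it
    misses a ball around 0. *)
Lemma phase_gap (Omega : set 'rV[R]_n) T (Gamma : set 'rV[R]_(1 + n)) (f : 'rV[R]_(1 + n) -> R) :
  bounded_set Omega -> Gamma `<=` lateral Omega T -> continuous f ->
  [set p | f p = 0] `&` closure Gamma = set0 ->
  exists2 eps, 0 < eps & forall p, Gamma p -> eps < `|f p|.
Proof.
move=> bO Gl cf disj; have [C hC] := lateral_bounded T bO.
have cG : compact (closure Gamma).
  apply: bounded_closed_compact; last exact: closed_closure.
  exists C; split; first exact: num_real.
  move=> D CD p /= clp; apply: (closure_norm_le _ clp) => q Gq.
  by apply: le_trans (ltW CD); apply/hC/Gl.
have : closed (f @` closure Gamma).
  apply: compact_closed; first exact: Rhausdorff.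
  by apply: continuous_compact => //; exact: continuous_subspaceT.
move=> /closed_openC /(_ 0)[].
  move=> [p Gp fp]; have : set0 p by rewrite -disj.
  by [].
move=> e /= e0 he; exists (e / 2); first lra.
move=> p Gp; rewrite ltNge; apply/negP => fpe.
have : (~` (f @` closure Gamma)) (f p).
  by apply: he; rewrite /ball/= sub0r normrN; lra.
by apply; exists p => //; exact: subset_closure.
Qed.

End Geometry.

(** * Construction of the unbounded conformal family *)

Theorem theorem1p1 (R : realType) (n : nat) (hn : (2 <= n)%N)
    (Omega : set 'rV[R]_n) (hopen : open Omega) (hbdd : bounded_set Omega)
    (hconn : connected Omega) (hbdry : has_smooth_boundary Omega)
    (T : R) (hT : 0 < T)
    (Gamma : set 'rV[R]_(1 + n))
    (hGamma : relatively_open (lateral Omega T) Gamma)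
    (H : set 'rV[R]_(1 + n)) (hH : lightlike_hyperplane H)
    (hHM : H `&` interior (cylinder Omega T) !=set0)
    (hHGamma : H `&` closure Gamma = set0) :
  exists G : set ('rV[R]_(1 + n) -> 'M[R]_(1 + n)),
    infinite_set [set g \_ (cylinder Omega T) | g in G] /\
    (forall g, G g ->
      [/\ smooth_lorentzian_metric (cylinder Omega T) g,
          partial_DN_map Omega T g Gamma Gamma =
            partial_DN_map Omega T (@minkowski_metric R n) Gamma Gamma,
          ~ (exists phi : 'rV[R]_(1 + n) -> 'rV[R]_(1 + n),
               [/\ diffeomorphism (cylinder Omega T) phi,
                   forall p, cylinder Omega T p ->
                     pullback phi (@minkowski_metric R n) p = g p &
                   forall p, Gamma p -> phi p = p]) &
          exists c : 'rV[R]_(1 + n) -> R,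
            [/\ smooth c,
                forall p, cylinder Omega T p -> 0 < c p &
                forall p, cylinder Omega T p -> g p = c p *: minkowski_metric p]]) /\
    (forall C : R, exists2 g, G g &
      (C%:E < Linfty_norm (cylinder Omega T) g)%E).
Proof.
(* With the space dimension written [n'.+1], the weight exponent n - 1 becomes [n']. *)
case: n hn Omega hopen hbdd hconn hbdry Gamma hGamma H hH hHM hHGamma => [//|n'] _.
move=> Omega _ hbdd _ _ Gamma hGamma H hH hHM hHGamma.
set M := cylinder Omega T.
have Gl : Gamma `<=` lateral Omega T by have [U _ ->] := hGamma; exact: subIsetl.
have [L [s [null HE]]] := null_phase hH.
have [p0 [Hp0 int0]] := hHM.
have Mp0 : M p0 by exact: interior_subset.
have phase0 : affine L s p0 = 0 by move: Hp0; rewrite HE.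
have cphase : continuous (affine L s) by exact: smooth_continuous (smooth_affine L s).
have disj : [set p | affine L s p = 0] `&` closure Gamma = set0 by rewrite -HE.
have [eps eps0 gap] := phase_gap hbdd Gl cphase disj.
have [b [wb b0 b1 bG]] := strip_bump L s eps0.
(* The amplitude [k.+1] is positive already for [k = 0], so every [E k] exceeds 1 at [p0], and it is
   unbounded in [k]. *)
pose E (k : nat) : 'rV[R]_(1 + n'.+1) -> R := cst 1 + cst k.+1%:R * b.
have EE k q : E k q = 1 + k.+1%:R * b q by [].
have wE k : wave_profile L (E k).
  apply: wave_profileD; first exact: wave_profile_cst.
  by apply: wave_profileM; first exact: wave_profile_cst.
have sE k : smooth (E k) by case: (wE k).
have E1 k q : 1 <= E k q.
  by rewrite EE lerDl mulr_ge0.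
have E0 k q : 0 < E k q by exact: lt_le_trans ltr01 (E1 k q).
have Ep0 k : E k p0 = 1 + k.+1%:R.
  by rewrite EE b1// mulr1.
have EG k p : Gamma p -> \forall q \near p, E k q = 1.
  move=> Gp; apply: filterS (bG p (gap p Gp)) => q bq.
  by rewrite EE bq mulr0 addr0.
have waveE k q : dalembertian (fun q => E k q ^+ n') q = 0.
  by apply: (wave_profile_dalembertian _ null); exact: wave_profileX.
pose a0 : 'I_(1 + n'.+1) := lshift n'.+1 0.
pose g k := conformal_metric (E k).
(* This single component at [p0] both separates the metrics of the family and makes their norms
   unbounded. *)
have g00 k : g k p0 a0 a0 = - (1 + k.+1%:R) ^+ 4.
  by rewrite /g /conformal_metric Ep0 mxE block_mxEul mxE eqxx mulrN1.
exists (range g); split; [|split].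
- have -> : [set h \_ M | h in range g] = [set g k \_ M | k in setT].
    by rewrite image_comp.
  have inj : {in [set: nat] &, injective (fun k => g k \_ M)}.
    move=> j k _ _ /(congr1 (fun h : 'rV[R]_(1 + n'.+1) -> 'M[R]_(1 + n'.+1) => h p0 a0 a0)).
    rewrite /patch mem_set// !g00 => /oppr_inj /eqP.
    rewrite eqrXn2// ?addr_ge0// => /eqP /addrI /eqP.
    by rewrite eqr_nat => /eqP [].
  by rewrite (eq_finite_set (inj_card_eq inj)); exact: infinite_nat.
- move=> _ [k _ <-]; split.
  + split.
      move=> a c; have -> : (fun p => g k p a c) =
          (fun p => E k p ^+ 4) * cst (@minkowski_mx R n'.+1 a c).
        by apply/funext => p; rewrite /g /conformal_metric mxE.
      exact: smoothM (smoothX 4 (sE k)) (smooth_cst _).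
    move=> p Mp; split; last first.
      by rewrite /g /conformal_metric form_scalemx minkowski_form_dt mulrN1 oppr_lt0 exprn_gt0.
    split; first by rewrite /g /conformal_metric linearZ/= minkowski_mx_tr.
    (* Congruence by the scalar matrix E^2 multiplies [eta] by E^4. *)
    exists (E k p ^+ 2)%:M.
      by rewrite unitmxE det_scalar unitfE !expf_neq0// gt_eqF.
    by rewrite tr_scalar_mx mul_mx_scalar mul_scalar_mx scalerA -exprD.
  + exact: (partial_DN_map_conformal (sE k) (E0 k) (waveE k) (EG k) Gl).
  + move=> [phi [[sphi [hphi _]] iso _]].
    apply: (conformal_not_isometric int0 (E1 k) _ sphi hphi iso).
    by rewrite Ep0 ltrDl.
  + exists (fun p => E k p ^+ 4); split; first exact: smoothX.
      by move=> p _; rewrite exprn_gt0.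
    by [].
(* [Num.bound] gives a natural number k above |C|, and the time component at [p0] has absolute value
   (k + 2)^4 >= k. *)
- move=> C; exists (g (Num.bound `|C|)) => //.
  apply: (@lt_le_trans _ _ ((1 + (Num.bound `|C|).+1%:R) ^+ 4)%:E).
    rewrite lte_fin; apply: le_lt_trans (real_ler_norm (num_real C)) _.
    have h := archi_boundP (normr_ge0 C).
    apply: (lt_le_trans h); apply: (@le_trans _ _ (1 + (Num.bound `|C|).+1%:R)).
      by rewrite -[X in X + _]/(1%:R) -natrD ler_nat addnS ltnW// ltnS leq_addl.
    by rewrite -[leLHS]expr1 ler_eXn2l// ltrDl.
  apply: ereal_sup_ubound; exists p0, a0, a0; split => //.
  by rewrite g00 normrN [X in _ = X%:E]ger0_norm // exprn_ge0 // addr_ge0.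
Qed.
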